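(* Let $I$ be an arbitrary set of indices and let $G=(X_i,P_i)_{i\in I}$ be a qualitative game such that, for every $i\in I$, $X_i=[0,1]$ and $P_i$ is an upper semicontinuous multi-valued map from $X=\prod_{j\in I}X_j$ into $X_i$ each of whose values is either empty or a nonempty closed convex set, and such that $\mathrm{Dom}(P_i)$ is perfectly normal. If $x_i\notin P_i(x)$ for every $i\in I$ and every $x=(x_j)_{j\in I}\in X$, then $G$ has an equilibrium, that is, there exists $y\in X$ such that $P_i(y)=\emptyset$ for every $i\in I$.
   Context: A qualitative game is a family $(X_i,P_i)_{i\in I}$, where $I$ is the set of players, $X_i$ is the set of strategies of player $i$, and $P_i$ is the preference correspondence of player $i$, a multi-valued map from $\prod_{j\in I}X_j$ into $X_i$. Here $[0,1]$ is the unit real interval with its usual topology, the product carries the product topology, and subsets are endowed with the induced topology. A multi-valued map $T$ from a space $E_1$ into a space $E_2$ assigns to each $x\in E_1$ a (possibly empty) subset $T(x)\subset E_2$; $\mathrm{Dom}(T)=\{x\in E_1 : T(x)\neq\emptyset\}$. The map $T$ is upper semicontinuous if for every $x_0\in E_1$ and every open subset $V$ of $E_2$ (including $V=\emptyset$) with $T(x_0)\subset V$ there is a neighborhood $O$ of $x_0$ in $E_1$ such that $T(x)\subset V$ for all $x\in O$. A separated (Hausdorff) space is perfectly normal if each of its closed subsets is a $G_\delta$-set, i.e. a countable intersection of open sets. *)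

(* Defs.v *)
From HB Require Import structures.
From mathcomp Require Export all_boot all_order all_algebra.
From mathcomp Require Export all_classical all_reals all_analysis borel_hierarchy.
Export numFieldNormedType.Exports.

Set Implicit Arguments.
Unset Strict Implicit.
Unset Printing Implicit Defensive.

Import Order.TTheory GRing.Theory Num.Theory.

Local Open Scope classical_set_scope.
Local Open Scope ring_scope.

Section multivalued_maps.
Context {E1 E2 : topologicalType}.
Implicit Type F : E1 -> set E2.

Definition Dom F : set E1 := [set x | F x !=set0].

Definition upper_semicontinuous F : Prop :=
  forall (x0 : E1) (V : set E2), open V -> F x0 `<=` V ->
    \forall x \near x0, F x `<=` V.

End multivalued_maps.

(* The Gdelta condition alone is required of closed sets, without an
   additional normality axiom. *)
Definition perfectly_normal (T : topologicalType) : Prop :=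
  hausdorff_space T /\ forall C : set T, closed C -> Gdelta C.

(* A game is represented by its preference correspondences, the strategy
   spaces [X i] being parameters and the profiles carrying the product
   topology. *)
Definition qualitative_game (I : Type) (X : I -> topologicalType) : Type :=
  forall i : I, prod_topology X -> set (X i).

Definition equilibrium (I : Type) (X : I -> topologicalType)
    (P : qualitative_game X) (y : prod_topology X) : Prop :=
  forall i : I, P i y = set0.

Definition unit_interval (R : realType) : set R := [set` `[0%R, 1%R]].
Arguments unit_interval : clear implicits.

(* Main.v *)
Require Import Defs.
From mathcomp Require Import ring.

(* The value P_i(x) is an interval avoiding x_i, so the points where it is
   nonempty split into those where it lies above x_i and those where it lies
   below. Upper semicontinuity makes both sets closed; they are disjoint, and
   Urysohn's lemma on the compact Hausdorff cube gives a continuous f_i equal to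
   1 on the first and 0 on the second. At a common zero of the functions
   h_i(x) = x_i - f_i(x) no P_i(x) can be nonempty: P_i(x) would have to lie
   above 1 or below 0. The h_i satisfy the sign conditions of Poincare-Miranda,
   which extends from finite to arbitrary products by compactness.

   Poincare-Miranda comes from Kuhn's cubical form of Sperner's lemma: for
   0/1-valued labels f_1, ..., f_n on a grid with f_k = 0 on x_k = 0 and f_k = 1
   on x_k = max, the sum over the grid of df_1 ... df_n mod 2 depends only on the
   boundary values, hence equals its value 1 for f_k = [x_k <> 0]; a nonzero term
   is a cube in which every label changes value. *)

Set Implicit Arguments.
Unset Strict Implicit.
Unset Printing Implicit Defensive.

Import Order.TTheory GRing.Theory Num.Theory.

Local Open Scope classical_set_scope.
Local Open Scope ring_scope.

(** * Kuhn's lemma *)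

Section GridForms.
Variables n N : nat.

Local Notation vertex := {ffun 'I_n -> 'I_N.+2}.
Local Notation form := ({set 'I_n} -> vertex -> 'F_2).
Implicit Types (v : vertex) (A B : {set 'I_n}) (w : form) (f g : vertex -> 'F_2).

Lemma addF2 (x : 'F_2) : x + x = 0.
Proof. by rewrite -mulr2n -mulr_natr (pchar_Fp_0 (isT : prime 2)) mulr0. Qed.

Definition step (j : 'I_n) : vertex :=
  [ffun i => if i == j then inord 1 else 0].

(* Noncommutative differential calculus mod 2 on the grid: [w A v] is the
   coefficient at [v] of the product of the [dx_j], [j \in A], and moving a
   function across [dx_j] shifts it by [step j]. Steps wrap around modulo
   [N.+2]; the cubes summed by [grid_sum] never wrap. *)
Definition one_form : form := fun A _ => (A == finset.set0)%:R.

Definition scale_form f w : form := fun A v => f v * w A v.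

Definition dform w : form := fun A v =>
  \sum_(j in A) (w (A :\ j)%SET (v + step j) + w (A :\ j)%SET v).

Definition dwedge f w : form := fun A v =>
  \sum_(j in A) (f (v + step j) + f v) * w (A :\ j)%SET (v + step j).

Definition inner v := [forall i, v i != ord_max].

Definition grid_sum w := \sum_(v | inner v) w finset.setT v.

(** Leibniz rule [d(f w) = df w + f dw]. It is exact because [dwedge] evaluates [w] at the shifted
    vertex; the cross terms cancel mod 2. *)
Lemma dform_scale f w A v :
  dform (scale_form f w) A v = dwedge f w A v + scale_form f (dform w) A v.
Proof.
rewrite /dform /dwedge /scale_form mulr_sumr -big_split; apply: eq_bigr => j _ /=.
by rewrite mulrDl mulrDr -addrA [f v * _ + (_ + _)]addrA addF2 add0r.
Qed.

(** The terms at [(j, k)] and [(k, j)] cancel mod 2. *)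
Lemma sum_offdiag_sym A (F : 'I_n -> 'I_n -> 'F_2) :
  (forall j k, F j k = F k j) -> \sum_(j in A) \sum_(k in (A :\ j)%SET) F j k = 0.
Proof.
move=> Fsym.
pose lo := \sum_(j in A) \sum_(k in A | (k < j)%N) F j k.
have hi : lo = \sum_(j in A) \sum_(k in A | (j < k)%N) F j k.
  rewrite /lo (exchange_big_dep (mem A)) /=; last by move=> j k _ /andP[].
  apply: eq_bigr => j jA; under eq_bigr do rewrite Fsym.
  by apply: eq_bigl => k; rewrite jA.
rewrite -[RHS](addF2 lo) {2}hi -big_split /=; apply: eq_bigr => j _.
rewrite (bigID (fun k : 'I_n => (k < j)%N)) /=.
congr (_ + _); apply: eq_bigl => k; rewrite finset.in_setD1 -val_eqE /=.
all: by case: ltngtP; rewrite ?andbF ?andbT.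
Qed.

Lemma dformK w A v : dform (dform w) A v = 0.
Proof.
rewrite /dform /=; under eq_bigr => j _ do rewrite -big_split /=.
apply: sum_offdiag_sym => j k; rewrite !finset.setDDl finset.setUC.
rewrite -[v + step j + _]addrA (addrC (step j)) addrA.
by rewrite -!addrA; congr (_ + _); rewrite addrCA.
Qed.

(** Apply [d] to the Leibniz rule written as [df w = d(f w) + f dw] and use [d d = 0]. *)
Lemma dform_wedge f w A v : dform (dwedge f w) A v = dwedge f (dform w) A v.
Proof.
have E B u : dwedge f w B u = dform (scale_form f w) B u + scale_form f (dform w) B u.
  by rewrite dform_scale -addrA addF2 addr0.
have -> : dwedge f w = fun B u =>
    dform (scale_form f w) B u + scale_form f (dform w) B u.
  by apply/funext => B; apply/funext => u; exact: E.
have -> : dform (fun B u => dform (scale_form f w) B u + scale_form f (dform w) B u) A v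
   = dform (dform (scale_form f w)) A v + dform (scale_form f (dform w)) A v.
  by rewrite /dform -big_split; apply: eq_bigr => j _ /=; rewrite addrACA.
by rewrite dformK add0r dform_scale /scale_form dformK mulr0 addr0.
Qed.

Lemma dform_one A v : dform one_form A v = 0.
Proof. by rewrite /dform big1 // => j _; rewrite addF2. Qed.

Definition wedge (F : 'I_n -> vertex -> 'F_2) (s : seq 'I_n) w : form :=
  foldr (fun k => dwedge (F k)) w s.

Lemma wedge_zero F s A v : wedge F s (fun _ _ => 0) A v = 0.
Proof.
elim: s A v => //= k s IH A v; rewrite /dwedge big1 // => j _.
by rewrite IH mulr0.
Qed.

Lemma dform_wedges F s w A v :
  dform (wedge F s w) A v = wedge F s (dform w) A v.
Proof.
elim: s A v => [//|k s IH] A v /=; rewrite dform_wedge.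
by apply: eq_bigr => j _; rewrite IH.
Qed.

Lemma wedgeD F s w w' A v :
  wedge F s (fun B u => w B u + w' B u) A v = wedge F s w A v + wedge F s w' A v.
Proof.
elim: s A v => [//|k s IH] A v /=; rewrite -big_split; apply: eq_bigr => j _ /=.
by rewrite IH mulrDr.
Qed.

(** Translation by [step j] permutes the vertices, wrapping around. The two ranges of summation
    differ only at terms where [h] is evaluated on a face orthogonal to [j], and these vanish. *)
Lemma grid_sum_shift j (h : vertex -> 'F_2) :
  (forall v, v j = 0 \/ v j = ord_max -> h v = 0) ->
  \sum_(v | inner v) h (v + step j) = \sum_(v | inner v) h v.
Proof.
move=> h0; rewrite [RHS](reindex_inj (addIr (step j))) /=.
rewrite [LHS]big_mkcond [RHS]big_mkcond; apply: eq_bigr => v _.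
have stepN i : i != j -> (v + step j) i = v i.
  by move=> /negPf ij; rewrite !ffunE ij addr0.
have [vj|vj] := eqVneq (v j) ord_max.
  rewrite h0 ?if_same //; left; rewrite !ffunE eqxx vj; apply: val_inj.
  by rewrite /= inordK // addn1 modnn.
have [vj'|vj'] := eqVneq ((v + step j) j) ord_max.
  by rewrite h0 ?if_same //; right.
congr (if _ then _ else _); apply: eq_forallb => i.
by have [->|/stepN ->//] := eqVneq i j; rewrite vj vj'.
Qed.

(** The restriction of [w] to the two faces orthogonal to [j] is zero; coefficients containing
    [dx_j] do not survive restriction, hence [j \notin A]. *)
Definition faceless j w := forall A v, j \notin A ->
  v j = 0 \/ v j = ord_max -> w A v = 0.

(** Stokes' theorem for a form vanishing on the boundary: each direction contributes a sum and its
    translate, which cancel. *)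
Lemma grid_sum_dform w : (forall j, faceless j w) -> grid_sum (dform w) = 0.
Proof.
move=> w0; rewrite /grid_sum /dform exchange_big big1 //= => j _.
by rewrite big_split /= (@grid_sum_shift j) ?addF2 // => v; apply: w0; rewrite !inE eqxx.
Qed.

Definition face_const j f := forall u v : vertex, u j = v j ->
  v j = 0 \/ v j = ord_max -> f u = f v.

(** Steps in directions other than [j] stay on the face, where [F j] is constant and its difference
    is zero. *)
Lemma faceless_wedge F s j w : j \in s -> face_const j (F j) ->
  faceless j (wedge F s w).
Proof.
move=> js Fj; elim: s js => //= k s IH; rewrite inE.
move=> + A v jA vj; rewrite /dwedge => ks; apply: big1 => i iA.
have ij : j != i by apply: contraNneq jA => ->.
have stepj : (v + step i) j = v j by rewrite !ffunE (negPf ij) addr0.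
case/orP: ks => [/eqP <-|ks]; first by rewrite (Fj _ v) // addF2 mul0r.
by rewrite IH ?mulr0 ?stepj // !inE (negPf jA) andbF.
Qed.

Lemma faceless_wedger F s j w : faceless j w -> faceless j (wedge F s w).
Proof.
move=> w0; elim: s => //= k s IH A v jA vj; rewrite /dwedge big1 // => i iA.
have ij : j != i by apply: contraNneq jA => ->.
have stepj : (v + step i) j = v j by rewrite !ffunE (negPf ij) addr0.
by rewrite IH ?mulr0 ?stepj // !inE (negPf jA) andbF.
Qed.

Definition proper_label (F : 'I_n -> vertex -> 'F_2) := forall k v,
  (v k = 0 -> F k v = 0) /\ (v k = ord_max -> F k v = 1).

Lemma proper_face_const F k : proper_label F -> face_const k (F k).
Proof.
move=> FP u v uv [vk|vk].
  by rewrite (FP k u).1 ?(FP k v).1 ?uv.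
by rewrite (FP k u).2 ?(FP k v).2 ?uv.
Qed.

(* Replacing one factor [dF_k] by [dF'_k] changes the form by an exact form
   vanishing on the boundary, so Stokes applies. *)
Lemma grid_sum_wedge_boundary F F' : proper_label F -> proper_label F' ->
  grid_sum (wedge F (enum 'I_n) one_form) = grid_sum (wedge F' (enum 'I_n) one_form).
Proof.
move=> FP FP'.
(* Factors are exchanged one at a time: those in [s1] already come from [F'], those in [s2] still
   from [F]. *)
suff H s1 s2 : s1 ++ s2 = enum 'I_n ->
    grid_sum (wedge F' s1 (wedge F s2 one_form)) =
    grid_sum (wedge F' (enum 'I_n) one_form).
  exact: (H [::]).
elim: s2 s1 => [|k s2 IH] s1; first by rewrite cats0 => ->.
move=> s12; rewrite -(IH (rcons s1 k)) ?cat_rcons // /wedge foldr_rcons -!/(wedge _ _ _).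
set w := wedge F s2 one_form.
have wcl A v : dform w A v = 0.
  rewrite dform_wedges; have -> : dform one_form = fun _ _ => 0.
    by apply/funext => B; apply/funext => u; rewrite dform_one.
  exact: wedge_zero.
pose g v : 'F_2 := F k v + F' k v.
have [sub0] : grid_sum (dform (wedge F' s1 (scale_form g w))) = 0.
  apply: grid_sum_dform => j.
  have : j \in enum 'I_n by rewrite mem_enum.
  (* For [j] in [s1] or [s2] the factor with index [j] kills the face; for [j = k] it is [g], since
     [F k] and [F' k] agree there. *)
  rewrite -s12 mem_cat inE => /or3P[js1|/eqP ->|js2].
  - exact/faceless_wedge/proper_face_const.
  - apply: faceless_wedger => A v _ [vk|vk]; rewrite /scale_form /g.
      by rewrite (FP k v).1 // (FP' k v).1 // addr0 mul0r.
    by rewrite (FP k v).2 // (FP' k v).2 // addF2 mul0r.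
  - apply: faceless_wedger => A v jA vj; rewrite /scale_form.
    by rewrite /w (@faceless_wedge F s2 j) ?mulr0 //; exact: proper_face_const.
rewrite -[RHS]addr0 -sub0 /grid_sum -big_split; apply: eq_bigr => v _ /=.
rewrite dform_wedges -wedgeD; congr (wedge F' s1 _ _ _).
apply/funext => B; apply/funext => u; rewrite dform_scale /scale_form wcl mulr0 addr0.
rewrite /dwedge -big_split; apply: eq_bigr => j _ /=.
rewrite -mulrDl; congr (_ * _); rewrite /g [F k (u + step j) + F' k _ + _]addrACA.
rewrite (addrC (F k (u + step j) + F k u) (F' k (u + step j) + F' k u)).
by rewrite addrA addF2 add0r.
Qed.

Definition coord_label (k : 'I_n) v : 'F_2 := (v k != 0)%:R.

Lemma ord_max_neq0 : (ord_max : 'I_N.+2) != 0.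
Proof. by rewrite -val_eqE. Qed.

Lemma coord_label_proper : proper_label coord_label.
Proof.
by move=> k v; rewrite /coord_label; split=> ->; rewrite ?eqxx ?ord_max_neq0.
Qed.

Lemma val_step v i j : v j != ord_max ->
  (v + step j) i = (v i + (i == j))%N :> nat.
Proof.
move=> vj; rewrite !ffunE; have [->|_] := eqVneq i j; last by rewrite addr0 addn0.
have := ltn_ord (v j); rewrite ltnS leq_eqVlt -[_ == N.+1]/(v j == ord_max).
by rewrite (negPf vj) /= inordK // => vjN; rewrite modn_small ?addn1.
Qed.

(** Label [k] changes only in direction [k], and only between 0 and 1 in that coordinate, so the
    origin is the only cube that counts. *)
Lemma wedge_coord_label s A v : uniq s -> A =i s ->
  (forall i, i \in A -> v i != ord_max) ->
  wedge coord_label s one_form A v = (all (fun k => v k == 0) s)%:R.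
Proof.
elim: s A v => [|k s IH] A v /= => [_ As _|/andP[ks us] As vA].
  rewrite /one_form (_ : A = finset.set0) ?eqxx //.
  by apply/finset.setP => i; rewrite As finset.in_set0.
have kA : k \in A by rewrite As inE eqxx.
rewrite /dwedge (bigD1 k) //= big1 ?addr0 => [|j /andP[_]]; last first.
  by rewrite eq_sym => /negPf kj; rewrite /coord_label !ffunE kj addr0 addF2 mul0r.
have stepE i : (v + step k) i = if i == k then v k + inord 1 else v i.
  by rewrite !ffunE; case: eqP => [->|]; rewrite ?addr0.
rewrite IH //; last 2 first.
- move=> i; rewrite finset.in_setD1 As inE.
  by have [->|] := eqVneq i k; rewrite ?(negPf ks).
- move=> i; rewrite finset.in_setD1 stepE => /andP[/negPf ->]; exact: vA.
have -> : all (fun i => (v + step k) i == 0) s = all (fun i => v i == 0) s.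
  apply: eq_in_all => i si; rewrite stepE; have [ik|//] := eqVneq i k.
  by rewrite -ik si in ks.
suff -> : coord_label k (v + step k) + coord_label k v = (v k == 0)%:R.
  by rewrite -natrM mulnb.
rewrite /coord_label -val_eqE /= val_step ?vA // eqxx addn1.
by case: (v k == 0); rewrite ?addr0 // addF2.
Qed.

Lemma grid_sum_coord_label :
  grid_sum (wedge coord_label (enum 'I_n) one_form) = 1.
Proof.
rewrite /grid_sum (bigD1 (0 : vertex)) /=; last first.
  by apply/forallP => i; rewrite ffunE eq_sym ord_max_neq0.
rewrite wedge_coord_label ?enum_uniq //; last 2 first.
- by move=> i; rewrite mem_enum inE.
- by move=> i _; rewrite ffunE eq_sym ord_max_neq0.
rewrite (_ : all _ _ = true); last by apply/allP => i _; rewrite ffunE.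
rewrite big1 ?addr0 // => v /andP[/forallP vi v0].
rewrite wedge_coord_label ?enum_uniq //; last by move=> i; rewrite mem_enum inE.
case: allP => // all0; case/eqP: v0; apply/ffunP => i.
by rewrite ffunE; apply/eqP/all0; rewrite mem_enum.
Qed.

(* A nonzero term of the iterated wedge is a monotone path in the cube along
   which every factor changes value. *)
Lemma wedge_neq0 F s A v : wedge F s one_form A v != 0 ->
  (forall i, i \in A -> v i != ord_max) ->
  {in s, forall k, exists u u' : vertex,
    [/\ forall i, (v i <= u i <= v i + (i \in A))%N,
        forall i, (v i <= u' i <= v i + (i \in A))%N & F k u != F k u']}.
Proof.
elim: s A v => // k0 s IH A v W0 vA.
have [j jA Wj] : exists2 j, j \in A &
   (F k0 (v + step j) + F k0 v) * wedge F s one_form (A :\ j)%SET (v + step j) != 0.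
  apply/exists2P/not_existsP => H; move/eqP: W0; apply; apply: big1 => j jA.
  by have := H j; rewrite jA => /not_andP[//|/negP/negPn/eqP].
have stepE i := val_step i (vA j jA).
move=> k; rewrite inE => /orP[/eqP ->|ks].
  exists (v + step j), v; split=> [i|i|].
  - by rewrite stepE leq_addr leq_add2l; case: eqP => // ->; rewrite jA.
  - by rewrite leqnn leq_addr.
  - by apply: contraNneq Wj => ->; rewrite addF2 mul0r.
have [|i|u [u' [uv u'v uu']]] := IH (A :\ j)%SET (v + step j) _ _ k ks.
- by apply: contraNneq Wj => ->; rewrite mulr0.
- rewrite finset.in_setD1 => /andP[ij iA]; apply: contraNneq (vA i iA) => vi.
  by rewrite -val_eqE -[eqbRHS]/(val (@ord_max N.+1)) -vi /= stepE (negPf ij) addn0.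
have bound (x : vertex) i :
    ((v + step j)%R i <= x i <= (v + step j)%R i + (i \in (A :\ j)%SET))%N ->
    (v i <= x i <= v i + (i \in A))%N.
  rewrite stepE finset.in_setD1; have [->|_] := eqVneq i j; last by rewrite addn0.
  by rewrite jA addn0 => /andP[+ ->]; rewrite addn1 => /ltnW ->.
by exists u, u'; split=> // i; exact: bound.
Qed.

Lemma kuhn (F : 'I_n -> vertex -> bool) :
  (forall k v, (v k = 0 -> ~~ F k v) /\ (v k = ord_max -> F k v)) ->
  exists v : 'I_n -> nat, forall k, exists u u' : vertex,
    [/\ forall i, (v i <= u i <= (v i).+1)%N,
        forall i, (v i <= u' i <= (v i).+1)%N, F k u & ~~ F k u'].
Proof.
move=> FP; pose G k v : 'F_2 := (F k v)%:R.
have GP : proper_label G.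
  move=> k v; rewrite /G; split=> vk; first by rewrite (negPf ((FP k v).1 vk)).
  by rewrite (FP k v).2.
have : grid_sum (wedge G (enum 'I_n) one_form) != 0.
  by rewrite (grid_sum_wedge_boundary GP coord_label_proper) grid_sum_coord_label.
move=> /eqP SG; have [v /forallP vi W0] : exists2 v, inner v &
    wedge G (enum 'I_n) one_form finset.setT v != 0.
  apply/exists2P/not_existsP => H; apply: SG; apply: big1 => v vi.
  by have := H v; rewrite vi => /not_andP[//|/negP/negPn/eqP].
exists (fun i => v i) => k.
have [u [u' [uv u'v]]] := wedge_neq0 W0 (fun i _ => vi i) (mem_enum _ k).
rewrite /G => uu'.
have uvS i : (v i <= u i <= (v i).+1)%N by have := uv i; rewrite inE addn1.
have u'vS i : (v i <= u' i <= (v i).+1)%N by have := u'v i; rewrite inE addn1.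
case Fu: (F k u); case Fu': (F k u'); rewrite ?Fu ?Fu' ?eqxx // in uu'.
  by exists u, u'; rewrite Fu Fu'.
by exists u', u; rewrite Fu Fu'.
Qed.

End GridForms.

(** * The Poincare-Miranda theorem *)

Definition unit_cube (R : realType) n : set 'rV[R]_n :=
  [set y | forall k, unit_interval R (y ord0 k)].

Definition grid_point (R : realType) n N (u : 'I_n -> nat) : 'rV[R]_n :=
  \row_k ((u k)%:R / N.+1%:R).

Lemma grid_point_cube (R : realType) n N (u : 'I_n -> nat) :
  (forall k, u k <= N.+1)%N -> @unit_cube R n (grid_point R N u).
Proof.
move=> uN k; rewrite /unit_interval /= mxE in_itv /= divr_ge0 //=.
by rewrite ler_pdivrMr ?ltr0n // mul1r ler_nat.
Qed.

Lemma grid_cluster (R : realType) n (v : nat -> 'I_n -> nat)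
    (y : 'rV[R]_n) (U : set 'rV[R]_n) :
  cluster ((fun N => grid_point R N (v N)) @ \oo) y -> nbhs y U ->
  exists N, forall u : 'I_n -> nat,
    (forall k, v N k <= u k <= (v N k).+1)%N -> U (grid_point R N u).
Proof.
move=> cy /nbhs_ballP[e /= e0 eU].
have e20 : 0 < e / 2 by rewrite divr_gt0.
pose small := [set N : nat | (e / 2)^-1 < N.+1%:R].
have bigN : \forall N \near \oo, small N.
  near=> N; rewrite /small /= (lt_le_trans (truncnS_gt _)) // ler_nat ltnS.
  by near: N; exact: nbhs_infty_ge.
pose p N := grid_point R N (v N).
(* Testing the cluster point against the image of [small] gives one [N] with both a fine mesh and a
   base corner near [y]; the two halves of [e] then cover the whole cube. *)
have [_ [[N /= NE <-] pN]] : (p @` small) `&` ball y (e / 2) !=set0.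
  apply: cy; last exact: nbhsx_ballx.
  by apply: filterS bigN => N ?; exists N.
exists N => u uv; apply: eU; apply: ball_split pN _; split=> // i k.
have N0 : 0 < N.+1%:R :> R by rewrite ltr0n.
rewrite /ball /= !mxE -mulrBl normrM [X in _ * X]ger0_norm ?invr_ge0 ?ltW //.
have small_step : N.+1%:R^-1 < e / 2 by rewrite invf_plt ?posrE.
apply: le_lt_trans small_step; rewrite distrC; apply: ler_piMl.
  by rewrite invr_ge0 ltW.
have /andP[vu uv1] := uv k.
rewrite -natrB // normr_nat. by rewrite -[leRHS]/(1%:R) ler_nat leq_subLR addn1.
Unshelve. all: by end_near. Qed.

Lemma poincare_miranda (R : realType) n (h : 'I_n -> 'rV[R]_n -> R) :
  (forall k, continuous (h k)) ->
  (forall k y, unit_cube y -> y ord0 k = 0 -> h k y <= 0) ->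
  (forall k y, unit_cube y -> y ord0 k = 1 -> 0 <= h k y) ->
  exists2 y, unit_cube y & forall k, h k y = 0.
Proof.
move=> hc h0 h1.
(* The second disjunct forces label 1 on the upper face, where [h k] may be zero. *)
pose F N k (u : {ffun 'I_n -> 'I_N.+2}) :=
  (0 < h k (grid_point R N (fun i => u i))) || (u k == ord_max).
have pcube N (u : {ffun 'I_n -> 'I_N.+2}) : unit_cube (grid_point R N (fun i => u i)).
  by apply: grid_point_cube => k; rewrite -ltnS.
have /choice[v vP] N : exists v : 'I_n -> nat, forall k,
    exists u u' : {ffun 'I_n -> 'I_N.+2},
    [/\ forall i, (v i <= u i <= (v i).+1)%N,
        forall i, (v i <= u' i <= (v i).+1)%N, F N k u & ~~ F N k u'].
  apply: kuhn => k u; split=> uk; last by rewrite /F uk eqxx orbT.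
  rewrite /F uk negb_or eq_sym ord_max_neq0 andbT -leNgt.
  by apply: h0 => //; rewrite mxE uk mul0r.
have cube_compact : compact (@unit_cube R n).
  exact: (@rV_compact _ _ (fun=> unit_interval R) (fun=> @segment_compact R 0 1)).
have pv N : unit_cube (grid_point R N (v N)).
  apply: grid_point_cube => k; have [u [_ [uv _ _ _]]] := vP N k.
  by have /andP[/leq_trans -> //] := uv k; rewrite -ltnS.
have [|y [ycube cy]] := cube_compact ((fun N => grid_point R N (v N)) @ \oo) _.
  by exists 0%N => // N _; exact: pv.
(* A strict sign of [h k y] persists on a whole small cube. A positive one contradicts the vertex
   labelled 0; a negative one puts the vertex labelled 1 on the upper face, where [h k] is
   nonnegative. *)
exists y => // k; apply/eqP; rewrite eq_le !leNgt; apply/andP; split; apply/negP => hy.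
- have /(grid_cluster cy)[N NP] : nbhs y (h k @^-1` [set t | 0 < t]).
    by apply: hc; apply: lt_nbhsr.
  have [_ [u' [_ uv' _]]] := vP N k; rewrite /F negb_or => /andP[/negP + _]; apply.
  exact: NP.
- have /(grid_cluster cy)[N NP] : nbhs y (h k @^-1` [set t | t < 0]).
    by apply: hc; apply: lt_nbhsl.
  have [u [_ [uv _ + _]]] := vP N k; have /= hu := NP _ uv.
  rewrite /F ltNge ltW //= => /eqP uk; move: hu; rewrite ltNge h1 // mxE uk.
  by rewrite divff // pnatr_eq0.
Qed.

(** * Poincare-Miranda on arbitrary products of unit intervals *)

Lemma prod_continuous (T : topologicalType) (I : Type) (K : I -> topologicalType)
    (g : T -> prod_topology K) :
  (forall i, continuous (fun y => g y i)) -> continuous g.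
Proof.
move=> gc y; apply/cvg_sup => i U [V [[W oW <-] Wgy VU]].
apply: filterS VU _; apply: (gc i y W); exact: open_nbhs_nbhs.
Qed.

Section Profiles.
Variables (R : realType) (I : Type).
Local Notation J := (unit_interval R : topologicalType).
Local Notation profile := (prod_topology (fun _ : I => J)).

Lemma proj_val_continuous (i : I) :
  continuous (fun x : profile => set_val (x i) : R).
Proof.
move=> x; apply: (@continuous_comp _ _ _ (fun x : profile => x i) set_val).
  exact: (@proj_continuous {classic I} (fun=> J)).
exact: initial_continuous.
Qed.

Lemma clamp_subproof (r : R) : Num.max 0 (Num.min 1 r) \in unit_interval R.
Proof.
rewrite inE /unit_interval /= in_itv /= le_max lexx /= ge_max ler01 /=.
by rewrite ge_min lexx.
Qed.

(** Retraction of the line onto [J]: it gives compactness of [J] and turns any real vector into a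
    profile. *)
Definition clamp (r : R) : J :=
  exist (fun t => t \in unit_interval R) _ (clamp_subproof r).

Lemma clamp_continuous : continuous clamp.
Proof.
apply: continuous_comp_initial => r /=.
apply: continuous_max; first exact: cst_continuous.
by apply: continuous_min; [exact: cst_continuous|exact: cvg_id].
Qed.

Lemma val_clamp (r : R) : unit_interval R r -> set_val (clamp r) = r.
Proof.
rewrite /unit_interval /= in_itv /= => /andP[r0 r1].
by rewrite set_valE /= min_r // max_r.
Qed.

Lemma unit_interval_compact : compact [set: J].
Proof.
have -> : [set: J] = clamp @` `[0, 1].
  apply/seteqP; split=> // t _; exists (set_val t).
    by have := set_valP t.
  by apply: val_inj; exact: (val_clamp (set_valP t)).
apply: continuous_compact; last exact: segment_compact.
exact/continuous_subspaceT/clamp_continuous.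
Qed.

Lemma profile_compact : compact [set: profile].
Proof.
have := @tychonoff {classic I} (fun=> J) (fun=> setT) (fun=> unit_interval_compact).
by congr (compact _); apply/seteqP; split.
Qed.

Lemma unit_interval_hausdorff : hausdorff_space J.
Proof.
move=> p q pq; apply: val_inj; apply: Rhausdorff => A B pA qB.
have vc : continuous (set_val : J -> R) by exact: initial_continuous.
by have [z [Az Bz]] := pq _ _ (vc p A pA) (vc q B qB); exists (set_val z).
Qed.

Lemma profile_hausdorff : hausdorff_space profile.
Proof.
exact: (@hausdorff_product {classic I} (fun=> J) (fun=> unit_interval_hausdorff)).
Qed.

Lemma miranda_profile_fin (h : I -> profile -> R) (s : seq {classic I}) :
  (forall i, continuous (h i)) ->
  (forall i x, set_val (x i) = 0 -> h i x <= 0) ->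
  (forall i x, set_val (x i) = 1 -> 0 <= h i x) ->
  exists x, {in s, forall i, h i x = 0}.
Proof.
(* Without duplicates, [index] inverts the enumeration of [t]; coordinates outside [t] are frozen at
   0. *)
move=> hc h0 h1; pose t := undup s; pose n := size t.
pose g (y : 'rV[R]_n) : profile := fun i : {classic I} =>
  clamp (if insub (index i t) is Some k then y ord0 k else 0).
have gc : continuous g.
  apply: prod_continuous => i y.
  apply: (@continuous_comp _ _ _
    (fun y : 'rV[R]_n =>
      if insub (index (i : {classic I}) t) is Some k then y ord0 k else 0)
    clamp); last exact: clamp_continuous.
  case: insub => [k|]; last exact: cst_continuous.
  exact: coord_continuous.
have gE y (k : 'I_n) : unit_cube y -> set_val (g y (tnth (in_tuple t) k)) = y ord0 k.
  move=> yc; rewrite /g (tnth_nth (tnth (in_tuple t) k)).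
  by rewrite index_uniq ?undup_uniq ?ltn_ord // valK val_clamp.
have [k|k y yc yk|k y yc yk|y yc hy] :=
    @poincare_miranda R n (fun k => h (tnth (in_tuple t) k) \o g).
- by move=> y; apply: continuous_comp; [exact: gc|exact: hc].
- by apply: h0; rewrite gE.
- by apply: h1; rewrite gE.
exists (g y) => i; rewrite -mem_undup -/t => /(@tnthP _ _ (in_tuple t))[k ->].
exact: hy.
Qed.

(** Common zero sets of finitely many [h i] are nonempty and generate a filter; a cluster point lies
    in each closed zero set. *)
Lemma miranda_profile (h : I -> profile -> R) :
  (forall i, continuous (h i)) ->
  (forall i x, set_val (x i) = 0 -> h i x <= 0) ->
  (forall i x, set_val (x i) = 1 -> 0 <= h i x) ->
  exists x, forall i, h i x = 0.
Proof.
move=> hc h0 h1.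
pose Z (s : seq {classic I}) := [set x | {in s, forall i, h i x = 0}].
have ZF : ProperFilter (filter_from [set: seq {classic I}] Z).
  apply: filter_from_proper; last first.
    move=> s _; exact: miranda_profile_fin.
  apply: filter_from_filter; first by exists [::].
  move=> s t _ _; exists (s ++ t) => // x xst.
  by split=> i si; apply: xst; rewrite mem_cat si ?orbT.
have [|x [_ xZ]] := profile_compact ZF; first exact: filterT.
exists x => i; have hcl : closed (h i @^-1` [set 0]).
  by apply: preimage_closed; [move=> y _; exact: hc|exact: closed_eq].
apply: hcl => U Ux; have [|y [yU hy]] := xZ (Z [:: i]) U _ Ux.
  by exists [:: i].
by exists y; split=> //; apply: yU; rewrite inE.
Qed.

End Profiles.

(** * Preference correspondences *)

Section Preference.
Variables (R : realType) (I : Type) (i : I).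
Local Notation J := (unit_interval R : topologicalType).
Local Notation profile := (prod_topology (fun _ : I => J)).
Variable P : profile -> set J.
Hypothesis P_usc : upper_semicontinuous P.
Hypothesis P_closed : forall x, closed (P x).
Hypothesis P_convex : forall x, convex_set (set_val @` P x : set R^o).
Hypothesis P_irrefl : forall x, ~ P x (x i).

(** Used with [s] equal to 1 or -1, to treat above and below at once. Profiles with empty value
    belong to both sides. *)
Definition on_side (s : R) : set profile :=
  [set x | forall t, P x t -> 0 < s * (set_val t - set_val (x i))].

Lemma on_side_open s : `|s| = 1 -> open (on_side s).
Proof.
move=> s1; rewrite openE => x sx.
have [W [[W' oW' <-] Wx WP]] : nbhs (x i) (~` P x).
  by apply: open_nbhs_nbhs; split; [exact: closed_openC|exact: P_irrefl].
have /nbhs_ballP[e /= e0 eW] : nbhs (set_val (x i)) W' by exact: open_nbhs_nbhs.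
have e20 : 0 < e / 2 by rewrite divr_gt0.
have snorm r : `|s * r| = `|r| by rewrite normrM s1 mul1r.
(* [P x] keeps distance at least [e] from [x i]: half of it survives in [V] for the nearby values,
   the other half absorbs the motion of [y i]. *)
pose V : set J := [set t | e / 2 < s * (set_val t - set_val (x i))].
have oV : open V.
  have fc : continuous (fun t : J => s * (set_val t - set_val (x i)) : R).
    move=> t; apply: (@continuousM R J (fun=> s)
      (fun t : J => set_val t - set_val (x i)) t).
      exact: cst_continuous.
    apply: (@continuousB R R J (fun t : J => set_val t) (fun=> set_val (x i)) t).
      exact: initial_continuous.
    exact: cst_continuous.
  move/continuousP: fc => /(_ [set r | e / 2 < r]); apply; exact: open_gt.
have PV : P x `<=` V.
  move=> t Pt; rewrite /V /=; apply: contrapT => /negP; rewrite -leNgt => st.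
  apply: (WP t) => //; apply: eW; rewrite /ball /= distrC -snorm.
  by rewrite gtr0_norm ?sx // (le_lt_trans st) // ltr_pdivrMr // ltr_pMr // ltr1n.
have xi : \forall y \near x, ball (set_val (x i) : R) (e / 2) (set_val (y i)).
  exact: (proj_val_continuous (nbhsx_ballx _ _ e20)).
near=> y => t Pyt.
have yV : P y `<=` V by near: y; exact: P_usc.
have : ball (set_val (x i) : R) (e / 2) (set_val (y i)) by near: y.
rewrite /ball /= distrC -snorm => /(le_lt_trans (ler_norm _)).
move=> /lt_trans /(_ (yV _ Pyt)).
by rewrite -subr_gt0 -mulrBr opprB addrA subrK.
Unshelve. all: by end_near. Qed.

Lemma on_side_cover x : on_side 1 x \/ on_side (-1) x.
Proof.
have neq t : P x t -> set_val t != set_val (x i).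
  by move=> Pt; apply: contra_notN (P_irrefl (x := x)) => /eqP/val_inj <-.
apply: contrapT => /not_orP[/existsNP[t /not_implyP[Pt]] + /existsNP[u /not_implyP[Pu]]].
rewrite mul1r subr_gt0 => /negP; rewrite -leNgt => tx.
rewrite mulN1r opprB subr_gt0 => /negP; rewrite -leNgt => xu.
set a := set_val t in tx; set b := set_val u in xu; set c := set_val (x i) in tx xu.
have ac : a < c by rewrite lt_neqAle neq.
have cb : c < b by rewrite lt_neqAle eq_sym neq.
have ab : 0 < b - a by rewrite subr_gt0 (lt_trans ac).
(* The weight of [a] that writes [c] as a convex combination of [a] and [b]. *)
have l0 : 0 <= (b - c) / (b - a) by rewrite divr_ge0 ?subr_ge0 // ltW // (lt_trans ac).
have l1 : (b - c) / (b - a) <= 1 by rewrite ler_pdivrMr // mul1r lerD2l lerN2.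
have := @P_convex x a b (Itv01 l0 l1).
rewrite !inE => /(_ (ex_intro2 _ _ t Pt erefl) (ex_intro2 _ _ u Pu erefl)).
move=> -[z Pz zc]; apply: (P_irrefl (x := x)).
suff <- : z = x i by [].
have zE : set_val z = (b - c) / (b - a) * a + (1 - (b - c) / (b - a)) * b := zc.
apply: val_inj; rewrite [LHS]zE -[RHS]/c.
have ab0 : b - a != 0 by rewrite gt_eqF.
by field.
Qed.

Lemma miranda_separator : exists h : profile -> R,
  [/\ continuous h, forall x, set_val (x i) = 0 -> h x <= 0,
      forall x, set_val (x i) = 1 -> 0 <= h x & forall x, h x = 0 -> P x = set0].
Proof.
have normal : normal_space profile.
  exact: compact_normal (@profile_hausdorff R I) (@profile_compact R I).
have clN s : `|s| = 1 -> closed (~` on_side s).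
  by move=> s1; apply: open_closedC; exact: on_side_open.
have dis : ~` on_side 1 `&` ~` on_side (-1) = set0.
  by apply/seteqP; split=> // x [n1 n2]; case: (on_side_cover x).
have [f [fc f0 f1 f01]] := urysohn_ext_itv normal (clN 1 (normr1 _))
  (clN (-1) (normrN1 _)) dis (@ltr01 R).
have fI x : 0 <= f x <= 1.
  by have := f01 (f x) (ex_intro2 _ _ x Logic.I erefl); rewrite /= in_itv.
have vI (t : J) : 0 <= (set_val t : R) <= 1.
  by have := set_valP t; rewrite /unit_interval /= in_itv.
exists (fun x => set_val (x i) - f x); split.
- move=> x; apply: (@continuousB R R profile (fun x => set_val (x i)) f x).
    exact: proj_val_continuous.
  exact: fc.
- by move=> x ->; rewrite sub0r oppr_le0; case/andP: (fI x).
- by move=> x ->; rewrite subr_ge0; case/andP: (fI x).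
move=> x /eqP; rewrite subr_eq0 => /eqP xf.
have neq t : P x t -> set_val t != set_val (x i).
  by move=> Pt; apply: contra_notN (P_irrefl (x := x)) => /eqP/val_inj <-.
(* Otherwise [f x = 0], so [x i] is 0 and every value of [P x], being different from it, lies above:
   a contradiction. Symmetrically at 1, so [x] is on both sides and [P x] is empty. *)
have s1 : on_side 1 x.
  apply: contrapT => n1; have fx0 : f x = 0 by apply: f0; exists x.
  apply: n1 => t Pt; rewrite mul1r xf fx0 subr0 lt_neqAle -{1}fx0 -xf eq_sym neq //=.
  by case/andP: (vI t).
have s2 : on_side (-1) x.
  apply: contrapT => n1; have fx1 : f x = 1 by apply: f1; exists x.
  apply: n1 => t Pt; rewrite mulN1r opprB subr_gt0 lt_neqAle neq //= xf fx1.
  by case/andP: (vI t).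
apply/seteqP; split=> // t Pt; have := s1 t Pt; have := s2 t Pt.
by rewrite mul1r mulN1r oppr_gt0 => /lt_trans h /h; rewrite ltxx.
Qed.

End Preference.

Theorem theorem3 (R : realType) (I : Type)
    (P : qualitative_game (fun _ : I => (unit_interval R : topologicalType))) :
  (forall i : I, upper_semicontinuous (P i)) ->
  (forall (i : I) x, P i x = set0 \/
    [/\ P i x !=set0, closed (P i x) &
        convex_set (set_val @` P i x : set R^o)]) ->
  (forall i : I, perfectly_normal (Dom (P i))) ->
  (forall (i : I) x, ~ P i x (x i)) ->
  exists y, equilibrium P y.
Proof.
move=> usc vals _ irr.
have Pcl i x : closed (P i x) by case: (vals i x) => [->|[]] //; exact: closed0.
have Pcv i x : convex_set (set_val @` P i x : set R^o).
  by case: (vals i x) => [->|[]] //; rewrite image_set0 => a b l; rewrite inE.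
have /choice[h hP] := fun i => miranda_separator (usc i) (Pcl i) (Pcv i) (irr i).
have [i|i|i|y hy] := @miranda_profile R I h; try by case: (hP i).
by exists y => i; case: (hP i) => _ _ _; apply.
Qed.
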